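(* Let $\{A_n\}_{n\geqslant 1}$ and $\{B_n\}_{n\geqslant 1}$ be two mutually independent sequences of i.i.d. random variables, and let $W_1\geqslant 0$ be a random variable independent of $\{(A_n,B_{n+1})\}_{n\geqslant 1}$. Define $X_{n+1}=B_{n+1}-A_n$ for $n\geqslant 1$ (so $X_2,X_3,\dots$ are i.i.d., distributed as a generic random variable $X$), and define recursively $$W_{n+1}=\max\{0,\,X_{n+1}-W_n\},\qquad n\geqslant 1.$$ Assume $\mathbb{P}[X>0]\in(0,1)$, and let $c(k)=\operatorname{cov}[W_1,W_{1+k}]$ for integers $k\geqslant 0$ (whenever these covariances exist). Then $c(k)\geqslant 0$ if $k$ is even and $c(k)\leqslant 0$ if $k$ is odd. If, in addition, $X$ has a strictly positive density on some interval $(a,b)$ with $0<a<b$, and $W_1$ has the limiting (stationary) waiting-time distribution of the recursion, i.e. $W_1\stackrel{D}{=}W$ where $W$ satisfies $W\stackrel{D}{=}\max\{0,X-W\}$ with $X$ independent of $W$, then $c(k)>0$ for every even $k$ and $c(k)<0$ for every odd $k$.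
   Context: This recursion models a single server alternating between two service points: $B_n$ is the preparation time of customer $n$, $A_n$ the service time of customer $n$, and $W_n$ the time the server waits before serving customer $n$. The distribution of $X$ need not be continuous for the first part of the statement. *)

(* Defs.v *)
From HB Require Import structures.
From mathcomp Require Import all_boot all_order all_algebra finmap.
From mathcomp Require Import all_classical all_reals all_analysis.

Set Implicit Arguments.
Unset Strict Implicit.
Unset Printing Implicit Defensive.

Import Order.TTheory GRing.Theory Num.Def Num.Theory.

Local Open Scope classical_set_scope.
Local Open Scope ring_scope.

Definition mutually_independent {d} {T : measurableType d} {R : realType}
  (P : probability T R) {I : choiceType} (X : I -> T -> R) : Prop :=
  forall (J : {fset I}) (Bs : I -> set R),
    (forall i, i \in J -> measurable (Bs i)) ->
    P (\bigcap_(i in [set` J]) (X i @^-1` Bs i)) =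
    (\prod_(i <- J) P (X i @^-1` Bs i))%E.

(* Independence of the random variable Z from the family Y, i.e. of sigma(Z)
   from sigma(Y_i, i in I), tested on the pi-system of finite-dimensional
   cylinder events generating sigma(Y_i, i in I). *)
Definition independent_of {d} {T : measurableType d} {R : realType}
  (P : probability T R) (Z : T -> R) {I : choiceType} (Y : I -> T -> R) : Prop :=
  forall (C : set R) (J : {fset I}) (Bs : I -> set R),
    measurable C ->
    (forall i, i \in J -> measurable (Bs i)) ->
    P (Z @^-1` C `&` \bigcap_(i in [set` J]) (Y i @^-1` Bs i)) =
    (P (Z @^-1` C) * P (\bigcap_(i in [set` J]) (Y i @^-1` Bs i)))%E.

Definition ident_distr {d} {T : measurableType d} {R : realType}
  (P : probability T R) (X Y : T -> R) : Prop :=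
  forall C : set R, measurable C -> P (X @^-1` C) = P (Y @^-1` C).

Definition AB_family {T R : Type} (A B : nat -> T -> R) (i : nat + nat) : T -> R :=
  match i with inl n => A n.+1 | inr n => B n.+1 end.

(* The family {(A_n, B_(n+1))}_{n>=1}:  inl n |-> A_(n+1), inr n |-> B_(n+2). *)
Definition AB_shift_family {T R : Type} (A B : nat -> T -> R) (i : nat + nat) : T -> R :=
  match i with inl n => A n.+1 | inr n => B n.+2 end.

(* waiting k = W_(k+1):  W_1 = W1, W_(n+1) = max(0, X_(n+1) - W_n) with
   X_(n+1) = B_(n+1) - A_n. *)
Fixpoint waiting {T : Type} {R : realType} (A B : nat -> T -> R) (W1 : T -> R)
  (k : nat) : T -> R :=
  match k with
  | 0 => W1
  | k'.+1 => fun t => Num.max 0 (B k'.+2 t - A k'.+1 t - waiting A B W1 k' t)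
  end.

(* Main.v *)
(* W_{k+1} is a 1-Lipschitz function of W_1, nondecreasing for even k and
   nonincreasing for odd k, given the increments X_2, ..., X_{k+1}.  Let m be
   the mean of W_1 and V the value of W_{k+1} when the path is started at the
   constant m instead.  V is independent of W_1, hence
     cov[W_1, W_{k+1}] = E[(W_1 - m) (W_{k+1} - V)],
   and (-1)^k times the integrand is nonnegative pointwise.

   In the stationary case, P[W_1 = 0] >= P[X <= 0] > 0, so that W_2, and
   therefore W_1, charges every interval that X charges inside (a, b).  With
   w0 = (2a + b)/3 and x0 = (a + 2b)/3, there is a positive probability that
   W_1 is close to w0, on the side away from m, while all increments are close
   to x0.  The path is then positive throughout, so that no maximum contracts
   differences and the integrand does not vanish. *)
Require Import Defs.
From HB Require Import structures.
From mathcomp Require Import all_boot all_order all_algebra finmap.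
From mathcomp Require Import all_classical all_reals all_analysis.
From mathcomp Require Import measurable_realfun ring lra.

Set Implicit Arguments.
Unset Strict Implicit.

Import Order.TTheory GRing.Theory Num.Def Num.Theory.
Local Open Scope classical_set_scope.
Local Open Scope ring_scope.

(** * Pathwise comparison of two solutions of the recursion *)

Lemma waiting_diff (T : Type) (R : realType) (A B : nat -> T -> R)
    (V V' : T -> R) (t : T) (k : nat) : V' t <= V t ->
  0 <= (-1) ^+ k * (waiting A B V k t - waiting A B V' k t) <= V t - V' t.
Proof.
move=> VV; elim: k => [|k]; first by rewrite expr0 mul1r lexx subr_ge0 VV.
rewrite exprS -signr_odd /=.
move: (waiting A B V k t) (waiting A B V' k t) (B _ _ - _) => u v x.
case: (odd k) => /=; rewrite ?expr0 ?expr1.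
  by rewrite !maxEle; do 2 case: ifPn; rewrite -?ltNge; lra.
by rewrite !maxEle; do 2 case: ifPn; rewrite -?ltNge; lra.
Qed.

Lemma waiting_ge0 (T : Type) (R : realType) (A B : nat -> T -> R)
    (V : T -> R) (t : T) (k : nat) : 0 <= V t -> 0 <= waiting A B V k t.
Proof. by case: k => //= k _; rewrite le_max lexx. Qed.

Lemma waiting_lipschitz (T : Type) (R : realType) (A B : nat -> T -> R)
    (V V' : T -> R) (t : T) (k : nat) :
  `|waiting A B V k t - waiting A B V' k t| <= `|V t - V' t|.
Proof.
wlog VV : V V' / V' t <= V t.
  by move=> h; have [/h//|/ltW/h] := leP (V' t) (V t); rewrite distrC (distrC (V t)).
have /andP[h1 h2] := waiting_diff A B k VV.
rewrite -[leLHS]mul1r -(normr_sign R (odd k)) signr_odd -normrM ger0_norm//.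
by rewrite ger0_norm// subr_ge0.
Qed.

Lemma waiting_mono_cov (T : Type) (R : realType) (A B : nat -> T -> R)
    (V V' : T -> R) (t : T) (k : nat) :
  0 <= (-1) ^+ k * ((V t - V' t) * (waiting A B V k t - waiting A B V' k t)).
Proof.
rewrite mulrCA; have [VV|/ltW VV] := leP (V' t) (V t).
  have /andP[h1 h2] := waiting_diff A B k VV.
  by rewrite mulr_ge0// subr_ge0.
have /andP[h1 h2] := waiting_diff A B k VV.
(* Exchanging [V] and [V'] negates both differences and so leaves the product unchanged. *)
rewrite -mulrNN -mulrN !opprB mulr_ge0// subr_ge0//.
Qed.

(* If every X_j is close to x0 and W_1 is close to w0 with 0 < w0 < x0, then
   the path follows the 2-cycle w0, x0 - w0, so that no maximum is attained
   at 0. *)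
Lemma waiting_near (T : Type) (R : realType) (A B : nat -> T -> R)
    (V : T -> R) (t : T) (k : nat) (w0 x0 e : R) :
  k.+1%:R * e <= w0 -> k.+1%:R * e <= x0 - w0 ->
  (forall j, (j < k)%N -> `|B j.+2 t - A j.+1 t - x0| < e) ->
  `|V t - w0| < e ->
  `|waiting A B V k t - (if odd k then x0 - w0 else w0)| < k.+1%:R * e /\
  forall j, (j < k)%N -> waiting A B V j t < B j.+2 t - A j.+1 t.
Proof.
move=> + + + Ve; have e0 : 0 < e by exact: le_lt_trans Ve.
elim: k => [|k IH] kw kx XE; first by rewrite mul1r.
move: kw kx; rewrite -natr1 mulrDl mul1r => kw kx.
have [|||IH1 IH2] := IH.
- lra.
- lra.
- by move=> j jk; apply: XE; rewrite ltnS ltnW.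
have Xk := XE k (ltnSn k).
(* The distance from [x0] to one point of the 2-cycle is the other point, which is at least
   [k.+2%:R * e]; this absorbs the error [k.+1%:R * e] of the path and the error [e] of the
   increment. *)
have kX : waiting A B V k t < B k.+2 t - A k.+1 t.
  move: IH1 Xk; rewrite !ltr_norml => /andP[h1 h2] /andP[h3 h4].
  move: h1 h2 kw kx; case: (odd k); lra.
split.
  rewrite /= maxEle ifT; last by rewrite subr_ge0 ltW.
  move: IH1 Xk; rewrite !ltr_norml => /andP[h1 h2] /andP[h3 h4].
  by move: h1 h2; case: (odd k) => /= h1 h2; lra.
by move=> j; rewrite ltnS leq_eqVlt => /predU1P[->//|/IH2].
Qed.

(** While both paths stay below the next increment, each step is the reflection [v |-> x - v], which
    only flips the sign of the difference. *)
Lemma waiting_diff_eq (T : Type) (R : realType) (A B : nat -> T -> R)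
    (V V' : T -> R) (t : T) (k : nat) :
  (forall j, (j < k)%N -> waiting A B V j t < B j.+2 t - A j.+1 t) ->
  (forall j, (j < k)%N -> waiting A B V' j t < B j.+2 t - A j.+1 t) ->
  (-1) ^+ k * (waiting A B V k t - waiting A B V' k t) = V t - V' t.
Proof.
elim: k => [|k IH] h h'; first by rewrite mul1r.
rewrite -IH; last 2 first.
- by move=> j jk; apply: h; rewrite ltnS ltnW.
- by move=> j jk; apply: h'; rewrite ltnS ltnW.
have := h k (ltnSn k); have := h' k (ltnSn k) => /= h1 h2.
rewrite !maxEle !ifT ?subr_ge0 ?(ltW h1) ?(ltW h2)//.
by rewrite exprS mulN1r mulNr -mulrN !opprB; congr (_ * _); lra.
Qed.

(* Moving W_1 from m across w0 moves W_{k+1} at least as much as moving it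
   from w0, since the k-step map is monotone. *)
Lemma waiting_mono_cov_gt0 (T : Type) (R : realType) (A B : nat -> T -> R)
    (V : T -> R) (t : T) (k : nat) (m w0 x0 e : R) :
  k.+1%:R * e <= w0 -> k.+1%:R * e <= x0 - w0 ->
  (forall j, (j < k)%N -> `|B j.+2 t - A j.+1 t - x0| < e) ->
  `|V t - w0| < e ->
  (m <= w0 < V t) || (V t < w0 <= m) ->
  0 < (-1) ^+ k * ((V t - m) * (waiting A B V k t - waiting A B (cst m) k t)).
Proof.
move=> kw kx XE Ve sides; rewrite mulrCA.
have e0 : 0 < e by exact: le_lt_trans Ve.
have [_ h1] := waiting_near kw kx XE Ve.
have [|_ h2] := waiting_near (t := t) (V := cst w0) kw kx XE.
  by rewrite subrr normr0.
have E := waiting_diff_eq h1 h2.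
have -> : waiting A B V k t - waiting A B (cst m) k t =
  (waiting A B V k t - waiting A B (cst w0) k t) +
  (waiting A B (cst w0) k t - waiting A B (cst m) k t) by lra.
rewrite mulrDr E.
case/orP: sides => /andP[s1 s2].
  have /andP[h _] := waiting_diff A B (t := t) (V := cst w0) (V' := cst m) k s1.
  by rewrite mulr_gt0//; move: h => /=; lra.
have /andP[h _] := waiting_diff A B (t := t) (V := cst m) (V' := cst w0) k s2.
rewrite -mulrNN mulr_gt0//; first by lra.
move: h => /=; rewrite -opprB mulrN; lra.
Qed.

(** * Independence: from cylinders to generated sigma-algebras and expectations *)

Section independence.
Context d (T : measurableType d) (R : realType) (P : probability T R).

Definition cylinders {I : choiceType} (Y : I -> T -> R) : set (set T) :=
  [set E | exists (J : {fset I}) (Bs : I -> set R),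
    (forall i, i \in J -> measurable (Bs i)) /\
    E = \bigcap_(i in [set` J]) (Y i @^-1` Bs i)].

Lemma setI_closed_cylinders (I : choiceType) (Y : I -> T -> R) :
  setI_closed (cylinders Y).
Proof.
move=> _ _ [J [Bs [mB ->]]] [J' [Bs' [mB' ->]]].
(* Padding each family by [setT] outside its own index set puts both cylinders over the common index
   set. *)
exists (J `|` J')%fset, (fun i => (if i \in J then Bs i else setT) `&`
                                  (if i \in J' then Bs' i else setT)).
split.
  by move=> i _; apply: measurableI; case: ifPn => // ?; [exact: mB|exact: mB'].
apply/seteqP; split => t /=.
  by move=> [h h'] i /= _; split; case: ifPn => // ?; [exact: h|exact: h'].
move=> h; split => i /= iJ.
  by have [] := h i; rewrite /= ?inE ?iJ.
by have [] := h i; rewrite /= ?inE ?iJ ?orbT.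
Qed.

Lemma measurable_cylinders (I : choiceType) (Y : I -> T -> R) :
  (forall i, measurable_fun setT (Y i)) -> cylinders Y `<=` measurable.
Proof.
move=> mY _ [J [Bs [mB ->]]]; apply: fin_bigcap_measurable.
  exact: finite_fset.
by move=> i iJ; rewrite -[X in measurable X]setTI; apply: mY => //; exact: mB.
Qed.

(** Pi-lambda argument: the events satisfying the product formula form a Dynkin system containing
    the pi-system of cylinders. *)
Lemma independent_of_sigma (Z : T -> R) (I : choiceType) (Y : I -> T -> R)
    (C : set R) (E : set T) :
  measurable_fun setT Z -> (forall i, measurable_fun setT (Y i)) ->
  independent_of P Z Y -> measurable C -> <<s cylinders Y >> E ->
  P (Z @^-1` C `&` E) = (P (Z @^-1` C) * P E)%E.
Proof.
move=> mZ mY ZY mC sE.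
have mZC : measurable (Z @^-1` C) by rewrite -[X in measurable X]setTI; exact: mZ.
suff: <<s cylinders Y >> `<=`
    [set E | measurable E /\ P (Z @^-1` C `&` E) = (P (Z @^-1` C) * P E)%E].
  by move=> /(_ _ sE)[].
apply: lambda_system_subset.
- exact: setI_closed_cylinders.
- apply/dynkin_lambda_system; split.
  + by split => //; rewrite setIT probability_setT mule1.
  + move=> F [mF PF]; split; first exact: measurableC.
    rewrite -setDE measureD//; last by rewrite -ge0_fin_numE// fin_num_measure.
    rewrite probability_setC// muleBr ?fin_num_measure//.
    by rewrite mule1 -PF.
  + move=> F tF mF; split.
      by apply: bigcup_measurable => k _; have [] := mF k.
    rewrite setI_bigcupr measure_bigcup//=; last 2 first.
    * by move=> k _; apply: measurableI => //; have [] := mF k.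
    * exact: trivIset_setIl.
    rewrite measure_bigcup//=; last by move=> k _; have [] := mF k.
    rewrite -(fineK (fin_num_measure P _ mZC)) -nneseriesZl//.
    rewrite fineK ?fin_num_measure//; apply: eq_eseriesr => k _.
    by have [_] := mF k.
- move=> _ [J [Bs [mB ->]]]; split; last exact: ZY.
  by apply: (measurable_cylinders mY); exists J, Bs.
- by [].
Qed.

(** The joint law agrees with the product of the marginal laws on rectangles, hence everywhere, and
    Tonelli factors the integral. *)
Lemma independent_expectation (U V : {RV P >-> R}) :
  (forall t, 0 <= U t) -> (forall t, 0 <= V t) ->
  (forall C D, measurable C -> measurable D ->
    P (U @^-1` C `&` V @^-1` D) = (P (U @^-1` C) * P (V @^-1` D))%E) ->
  ('E_P[(U : T -> R) * V] = 'E_P[U] * 'E_P[V])%E.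
Proof.
move=> U0 V0 UV.
pose uv t := (U t, V t).
have mUV : measurable_fun setT uv by exact: measurable_fun_pair.
pose UV' : {mfun T >-> _} := HB.pack uv (isMeasurableFun.Build _ _ _ _ _ mUV).
(* The absolute values make the integrand nonnegative on the whole plane, as Tonelli requires, and
   change nothing on the range of [(U, V)]. *)
pose g (z : R * R) : \bar R := (`|z.1| * `|z.2|)%:E.
have mg : measurable_fun setT g.
  apply/measurable_EFinP; apply: measurable_funM.
    by apply: measurableT_comp => //; exact: measurable_fst.
  by apply: measurableT_comp => //; exact: measurable_snd.
have g0 z : (0 <= g z)%E by rewrite lee_fin mulr_ge0.
have mabs : measurable_fun [set: R] (fun x => `|x|%:E).
  by apply/measurable_EFinP; exact: normr_measurable.
have absE (X : {RV P >-> R}) : (forall t, 0 <= X t) ->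
    (\int[distribution P X]_x `|x|%:E = 'E_P[X])%E.
  move=> X0; rewrite unlock ge0_integral_distribution//.
  by apply: eq_integral => t _ /=; rewrite ger0_norm.
rewrite -(absE _ U0) -(absE _ V0) unlock.
transitivity (\int[distribution P UV']_z g z)%E.
  rewrite ge0_integral_distribution//; apply: eq_integral => t _ /=.
  by rewrite /g /= !ger0_norm.
transitivity (\int[distribution P U \x distribution P V]_z g z)%E.
  apply: eq_measure_integral => A mA _.
  by apply/esym/product_measure_unique => // C D mC mD; rewrite -UV.
rewrite fubini_tonelli1// /fubini_F /=.
under eq_integral => x _.
  under eq_integral => y _ do rewrite /g /= EFinM.
  rewrite ge0_integralZl//.
  over.
rewrite ge0_integralZr//.
by apply: integral_ge0.
Qed.
End independence.

Lemma measurable_waiting d (T : measurableType d) (R : realType)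
    (A B : nat -> T -> R) (V : T -> R) (k : nat) :
  (forall n, measurable_fun setT (A n.+1)) ->
  (forall n, measurable_fun setT (B n.+2)) ->
  measurable_fun setT V -> measurable_fun setT (waiting A B V k).
Proof.
move=> mA mB mV; elim: k => //= k IH.
apply: measurable_maxr => //; apply: measurable_funB => //.
exact: measurable_funB.
Qed.

(** A path with a constant start depends on the family [AB_shift_family A B] alone, so its events
    lie in the sigma-algebra generated by that family. *)
Lemma waiting_cst_independent d (T : measurableType d) (R : realType)
    (P : probability T R) (A B : nat -> T -> R) (U : T -> R) (c : R) (k : nat)
    (C D : set R) :
  (forall n, measurable_fun setT (A n)) ->
  (forall n, measurable_fun setT (B n)) -> measurable_fun setT U ->
  independent_of P U (AB_shift_family A B) ->
  measurable C -> measurable D ->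
  P (U @^-1` C `&` waiting A B (cst c) k @^-1` D) =
  (P (U @^-1` C) * P (waiting A B (cst c) k @^-1` D))%E.
Proof.
move=> mA mB mU UAB mC mD.
apply: (independent_of_sigma _ _ UAB) => //.
  by case=> n; [exact: mA|exact: mB].
(* Equipping the sample space with the generated sigma-algebra turns membership in it into
   measurability, so [measurable_waiting] applies again. *)
pose T' := g_sigma_algebraType (cylinders (AB_shift_family A B)).
have mY i : measurable_fun [set: T'] (AB_shift_family A B i : T' -> R).
  move=> _ E mE; rewrite setTI; apply: sub_sigma_algebra.
  exists [fset i]%fset, (fun=> E); split => //.
  by rewrite set_fset1 bigcap_set1.
have mW : measurable_fun [set: T'] (waiting A B (cst c) k : T' -> R).
  apply: measurable_waiting => // n; [exact: (mY (inl n))|exact: (mY (inr n))].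
by have := mW measurableT D mD; rewrite setTI.
Qed.

(** * Strict positivity of integrals, and covariances with an independent part subtracted *)

Section expectation.
Context d (T : measurableType d) (R : realType).

(** A zero integral would make [f] vanish almost everywhere on [D], so that [E] would lie in a null
    set. *)
Lemma integral_gt0 (mu : {measure set T -> \bar R}) (D E : set T) (f : T -> R) :
  measurable D -> measurable_fun D f -> (forall x, D x -> 0 <= f x) ->
  measurable E -> E `<=` D -> (forall x, E x -> 0 < f x) ->
  (0 < mu E)%E -> (0 < \int[mu]_(x in D) (f x)%:E)%E.
Proof.
move=> mD mf f0 mE ED fE muE.
rewrite lt_neqAle integral_ge0 ?andbT; last by move=> x Dx; rewrite lee_fin f0.
apply/negP => /eqP f_eq0; move: muE; apply/negP; rewrite -leNgt.
have mf' : measurable_fun D (EFin \o f) by exact/measurable_EFinP.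
have [|N [mN muN DN]] := (ae_eq_integral_abs mu mD mf').1.
  rewrite f_eq0; apply: eq_integral => x; rewrite inE => Dx /=.
  by rewrite ger0_norm// f0.
rewrite -muN le_measure ?inE// => x Ex; apply: DN => /= /(_ (ED _ Ex)) -[fx0].
by have := fE _ Ex; rewrite fx0 ltxx.
Qed.

Variable P : probability T R.

Lemma Lfun1_mul_independent (U V : {RV P >-> R}) :
  (forall t, 0 <= U t) -> (forall t, 0 <= V t) ->
  (U : T -> R) \in Lfun P 1 -> (V : T -> R) \in Lfun P 1 ->
  (forall C D, measurable C -> measurable D ->
    P (U @^-1` C `&` V @^-1` D) = (P (U @^-1` C) * P (V @^-1` D))%E) ->
  (U : T -> R) * V \in Lfun P 1.
Proof.
move=> U0 V0 U1 V1 UV; apply/Lfun1_integrable/integrableP; split.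
  by apply/measurable_EFinP; exact: measurable_funM.
have := independent_expectation U0 V0 UV.
rewrite {1}unlock => h; rewrite (_ : (\int[P]_x _)%E = ('E_P[U] * 'E_P[V])%E).
  by rewrite ltey_eq fin_numM ?expectation_fin_num.
by rewrite -h; apply: eq_integral => t _ /=; rewrite ger0_norm// mulr_ge0.
Qed.

(** Expanding ['E_P[D]], the terms in [V] are ['E_P[U * V]] and ['E_P[U] * 'E_P[V]], which cancel by
    independence; the rest is the covariance of [U] and [Z]. *)
Lemma covariance_sub_independent (U V : {RV P >-> R}) (Z : T -> R) :
  (forall t, 0 <= U t) -> (forall t, 0 <= V t) ->
  (U : T -> R) \in Lfun P 1 -> (V : T -> R) \in Lfun P 1 ->
  Z \in Lfun P 1 -> (U : T -> R) * Z \in Lfun P 1 ->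
  (forall C D, measurable C -> measurable D ->
    P (U @^-1` C `&` V @^-1` D) = (P (U @^-1` C) * P (V @^-1` D))%E) ->
  let D := fun t => (U t - fine 'E_P[U]) * (Z t - V t) in
  D \in Lfun P 1 /\ covariance P U Z = 'E_P[D]%E.
Proof.
move=> U0 V0 U1 V1 Z1 UZ1 UV D.
have UV1 : (U : T -> R) * V \in Lfun P 1 by exact: Lfun1_mul_independent.
set m := fine 'E_P[U] in D *.
have DE : D = (((U : T -> R) * Z \- (U : T -> R) * V) \- (m \o* Z \- m \o* V))%R.
  by apply/funext => t; rewrite /D !fctE /=; ring.
have ? : m \o* Z \in Lfun P 1 by apply: Lfun_scale.
have ? : m \o* V \in Lfun P 1 by apply: Lfun_scale.
split; first by rewrite DE !rpredB.
rewrite DE !expectationB ?rpredB//= !expectationZl// covarianceE//.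
rewrite (independent_expectation U0 V0 UV).
rewrite -(fineK (expectation_fin_num UZ1)) -(fineK (expectation_fin_num U1)).
rewrite -(fineK (expectation_fin_num V1)) -(fineK (expectation_fin_num Z1)).
rewrite -/m -!EFinM -!EFinB; congr (_%:E); ring.
Qed.

End expectation.

(** * The signed covariance as the expectation of a pointwise nonnegative variable *)

Section covariance_waiting.
Context d (T : measurableType d) (R : realType) (P : probability T R).
Variables (A B : nat -> T -> R) (W1 : {RV P >-> R}).
Hypothesis mA : forall n, measurable_fun setT (A n).
Hypothesis mB : forall n, measurable_fun setT (B n).
Hypothesis W1_ge0 : forall t, 0 <= W1 t.
Hypothesis W1_AB : independent_of P W1 (AB_shift_family A B).

(* The path started at the constant E[W_1] is independent of W_1, so it can be
   subtracted from W_{k+1}; it stays within |W_1 - E[W_1]| of W_{k+1}, so it is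
   integrable as well. *)
Lemma covariance_waiting (k : nat) :
  (W1 : T -> R) \in Lfun P 1 -> waiting A B W1 k \in Lfun P 1 ->
  (W1 : T -> R) * waiting A B W1 k \in Lfun P 1 ->
  let m := fine 'E_P[W1] in
  let D := fun t =>
    (-1) ^+ k * ((W1 t - m) * (waiting A B W1 k t - waiting A B (cst m) k t)) in
  measurable_fun setT D /\
  (((-1) ^+ k)%:E * covariance P W1 (waiting A B W1 k) = 'E_P[D])%E.
Proof.
move=> W1L WkL WWL m D.
have mW : measurable_fun setT (waiting A B W1 k) by exact: measurable_waiting.
have mV : measurable_fun setT (waiting A B (cst m) k) by exact: measurable_waiting.
have m0 : 0 <= m by rewrite fine_ge0 ?expectation_ge0.
pose V : {RV P >-> R} := HB.pack (waiting A B (cst m) k)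
  (isMeasurableFun.Build _ _ _ _ _ mV).
have VL : (V : T -> R) \in Lfun P 1.
  have -> : (V : T -> R) = waiting A B W1 k \- (waiting A B W1 k \- V).
    by apply/funext => t /=; lra.
  rewrite rpredB//; apply/Lfun1_integrable.
  apply: (@le_integrable _ _ _ _ _ measurableT _ (EFin \o (W1 \- cst m))).
  - by apply/measurable_EFinP; exact: measurable_funB.
  - by move=> t _; rewrite /= lee_fin; exact: waiting_lipschitz.
  - by apply/Lfun1_integrable; rewrite rpredB// Lfun_cst.
have [||DL ->] := covariance_sub_independent (Z := waiting A B W1 k)
  W1_ge0 (V := V) _ W1L VL WkL WWL.
- by move=> t; apply: waiting_ge0.
- by move=> C E mC mE; exact: waiting_cst_independent.
split.
  apply: measurable_funM => //; apply: measurable_funM; exact: measurable_funB.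
rewrite -expectationZl//; congr expectation.
by apply/funext => t /=; rewrite mulrC.
Qed.

End covariance_waiting.

Lemma alternating_sign_ge0 (R : realType) (x : \bar R) (k : nat) :
  (0 <= ((-1) ^+ k)%:E * x)%E -> if odd k then (x <= 0)%E else (0 <= x)%E.
Proof.
rewrite -signr_odd; case: (odd k);
  by rewrite ?expr1 ?expr0 ?mul1e// EFinN mulN1e oppe_ge0.
Qed.

Lemma alternating_sign_gt0 (R : realType) (x : \bar R) (k : nat) :
  (0 < ((-1) ^+ k)%:E * x)%E -> if odd k then (x < 0)%E else (0 < x)%E.
Proof.
rewrite -signr_odd; case: (odd k);
  by rewrite ?expr1 ?expr0 ?mul1e// EFinN mulN1e oppe_gt0.
Qed.

(* The strip {c < u - v < e} is a countable union of rectangles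
   ]c + q2, e + q1[ x ]q1, q2[ with rational q1, q2. *)
Lemma charged_rectangle d (T : measurableType d) (R : realType)
    (P : probability T R) (U V : {RV P >-> R}) (c e : R) :
  (0 < P [set t | (c < U t - V t < e)%R])%E ->
  exists I J : set R, [/\ measurable I, measurable J,
    forall u v, I u -> J v -> c < u - v < e &
    (0 < P (U @^-1` I `&` V @^-1` J))%E].
Proof.
move=> UVce; pose I (q : rat * rat) : set R := `]c + ratr q.2, e + ratr q.1[%classic.
pose J (q : rat * rat) : set R := `]ratr q.1, ratr q.2[%classic.
pose F q := U @^-1` I q `&` V @^-1` J q.
have mF q : measurable (F q) by apply: measurableI; apply: measurable_funPTI; exact: measurable_itv.
have [[q Fq]|noF] := pselect (exists q, 0 < P (F q))%E.
  exists (I q), (J q); split; [exact: measurable_itv|exact: measurable_itv| |by []].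
  move=> u v; rewrite /I /J /= !in_itv /= => /andP[h1 h2] /andP[h3 h4].
  by apply/andP; split; lra.
move: UVce; rewrite ltNge => /negP; case.
(* If every rational rectangle were null, so would be their countable union. [unpickle] enumerates
   the pairs of rationals; integers coding no pair contribute [set0]. *)
have : P.-negligible (\bigcup_n (oapp F set0 (choice.unpickle n))).
  apply: negligible_bigcup => n; case: choice.unpickle => [q|]; last exact: negligible_set0.
  apply/(negligibleP _ (mF q))/eqP; rewrite eq_le measure_ge0 andbT leNgt.
  by apply/negP => Fq; apply: noF; exists q.
move=> [N [mN PN FN]]; rewrite -PN le_measure ?inE//.
  rewrite (_ : [set _ | _] = (U \- V) @^-1` `]c, e[%classic).
    by rewrite -[X in measurable X]setTI; apply: measurable_funB.
  by apply/seteqP; split => t; rewrite /= in_itv.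
move=> t /= /andP[cUV UVe]; apply: FN.
have /rat_in_itvoo[q1] : U t - e < V t by lra.
rewrite in_itv /= => /andP[h1 h2].
have /rat_in_itvoo[q2] : V t < U t - c by lra.
rewrite in_itv /= => /andP[h3 h4].
exists (choice.pickle (q1, q2)); first exact: Logic.I.
rewrite [X in X t](_ : _ = F (q1, q2)); last by rewrite choice.pickleK.
split; rewrite /I /J /preimage /mkset in_itv /=.
  by apply/andP; split; lra.
by apply/andP; split; lra.
Qed.

(** * Events of positive probability that control the first increments *)

Section path_event.
Context d (T : measurableType d) (R : realType) (P : probability T R).
Variables (A B : nat -> {RV P >-> R}).
Let A' := fun n => A n : T -> R.
Let B' := fun n => B n : T -> R.

(** The conditions bear on the [A] and [B] coordinates separately, not on their differences, so that
    independence applies to them directly. *)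
Definition path_event (I J : set R) (k : nat) : set T :=
  [set t | forall j, (j < k)%N -> J (A j.+1 t) /\ I (B j.+2 t)].

Lemma path_event_cylinder (I J : set R) (k : nat) :
  measurable I -> measurable J ->
  cylinders (AB_shift_family A' B') (path_event I J k).
Proof.
move=> mI mJ.
exists [fset x in [seq inl j | j <- iota 0 k] ++ [seq inr j | j <- iota 0 k]]%fset.
exists (fun i : nat + nat => if i is inl _ then J else I); split; first by case.
apply/seteqP; split => t /= h.
  move=> i /=; rewrite !inE => /orP[] /mapP[j];
    by rewrite mem_iota add0n => /h[? ?] ->.
move=> j jk; split.
  by apply: (h (inl j)); rewrite /= !inE map_f// mem_iota.
by apply: (h (inr j)); rewrite /= !inE map_f ?orbT// mem_iota.
Qed.

(** By independence and identical distribution, the probability is a finite product of the two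
    positive numbers in the hypotheses. *)
Lemma path_event_gt0 (I J : set R) (k : nat) :
  mutually_independent P (AB_family A' B') ->
  (forall n, (1 <= n)%N -> ident_distr P (A n) (A 1%N)) ->
  (forall n, (1 <= n)%N -> ident_distr P (B n) (B 1%N)) ->
  measurable I -> measurable J ->
  (0 < P (B 2%N @^-1` I))%E -> (0 < P (A 1%N @^-1` J))%E ->
  (0 < P (path_event I J k))%E.
Proof.
move=> indAB idA idB mI mJ BI AJ.
(* [AB_family] sends [inr n] to [B n.+1], so [B j.+2] has index [inr j.+1] here, whereas its index
   in [AB_shift_family] is [inr j]. *)
pose K := [fset x in [seq inl j | j <- iota 0 k] ++
                     [seq inr j.+1 | j <- iota 0 k]]%fset : {fset nat + nat}.
pose Bs (i : nat + nat) := if i is inl _ then J else I.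
have -> : path_event I J k = \bigcap_(i in [set` K]) (AB_family A' B' i @^-1` Bs i).
  apply/seteqP; split => t /= h.
    move=> i /=; rewrite !inE => /orP[] /mapP[j];
      by rewrite mem_iota add0n => /h[? ?] ->.
  move=> j jk; split.
    by apply: (h (inl j)); rewrite /= !inE map_f// mem_iota.
  apply: (h (inr j.+1)); rewrite /= !inE; apply/orP; right.
  by apply/mapP; exists j; rewrite // mem_iota.
rewrite indAB; last by case.
elim/big_ind : _ => // [x y|[n|n] _]; first exact: mule_gt0.
  by rewrite /= idA.
by rewrite /= idB// -(idB 2%N).
Qed.

End path_event.

(** * The stationary case: support of the waiting time and strict signs *)

Section stationary.
Context d (T : measurableType d) (R : realType) (P : probability T R).
Variables (A B : nat -> {RV P >-> R}) (W1 : {RV P >-> R}).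
Let A' := fun n => A n : T -> R.
Let B' := fun n => B n : T -> R.
Let W := waiting A' B' W1.
Hypothesis indAB : mutually_independent P (AB_family A' B').
Hypothesis idA : forall n, (1 <= n)%N -> ident_distr P (A n) (A 1%N).
Hypothesis idB : forall n, (1 <= n)%N -> ident_distr P (B n) (B 1%N).
Hypothesis W1_ge0 : forall t, 0 <= W1 t.
Hypothesis W1_AB : independent_of P W1 (AB_shift_family A' B').

Lemma measurable_path_event (I J : set R) (k : nat) :
  measurable I -> measurable J -> measurable (path_event A B I J k).
Proof.
move=> mI mJ; apply: (@measurable_cylinders _ _ _ _ (AB_shift_family A' B')).
  by case=> n; exact: measurable_funPT.
exact: path_event_cylinder.
Qed.

(** One charged rectangle inside the strip confines a single increment; imposing it at all [k] steps
    keeps positive probability, and independence of [W1] allows the condition on the start. *)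
Lemma charged_path (C : set R) (c e : R) (k : nat) :
  measurable C -> (0 < P (W1 @^-1` C))%E ->
  (0 < P [set t | (c < B 2%N t - A 1%N t < e)%R])%E ->
  exists E : set T, [/\ measurable E, (0 < P E)%E, E `<=` W1 @^-1` C &
    forall t, E t -> forall j, (j < k)%N -> c < B j.+2 t - A j.+1 t < e].
Proof.
move=> mC PC /charged_rectangle[I [J [mI mJ IJ PIJ]]].
have mA1J : measurable (A 1%N @^-1` J) by exact: measurable_funPTI.
have mB2I : measurable (B 2%N @^-1` I) by exact: measurable_funPTI.
have mE := measurable_path_event k mI mJ.
exists (W1 @^-1` C `&` path_event A B I J k); split.
- by apply: measurableI => //; exact: measurable_funPTI.
- rewrite (independent_of_sigma _ _ W1_AB)//; last 2 first.
  + by case=> n; exact: measurable_funPT.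
  + by apply: sub_sigma_algebra; exact: path_event_cylinder.
  rewrite mule_gt0// path_event_gt0//; apply: lt_le_trans PIJ _;
    by rewrite le_measure ?inE//; exact: measurableI.
- exact: subIsetl.
- by move=> t [_ h] j /h[Jt It]; exact: IJ.
Qed.

Hypothesis W1_stationary : ident_distr P (W 1%N) (W 0%N).
Hypothesis X_lt1 : (P [set t | (0 < B 2%N t - A 1%N t)%R] < 1)%E.

Let mW1 : measurable_fun setT (W 1%N).
Proof. by apply: measurable_waiting => n; exact: measurable_funPT. Qed.

Lemma stationary_atom0 : (0 < P (W1 @^-1` [set 0%R]))%E.
Proof.
have mX : measurable [set t | (0 < B 2%N t - A 1%N t)%R].
  rewrite (_ : [set _ | _] = (B 2%N \- A 1%N) @^-1` `]0, +oo[%classic).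
    by rewrite -[X in measurable X]setTI; apply: measurable_funB.
  by apply/seteqP; split => t; rewrite /= in_itv /= andbT.
rewrite -(W1_stationary (measurable_set1 0)).
apply: (@lt_le_trans _ _ (P (~` [set t | (0 < B 2%N t - A 1%N t)%R]))).
  by rewrite probability_setC// sube_gt0.
rewrite le_measure ?inE//.
- exact: measurableC.
- by rewrite -[X in measurable X]setTI; exact: mW1.
- move=> t /= /negP; rewrite -leNgt => X0.
  apply/max_idPl; rewrite /A' /B'; have := W1_ge0 t; lra.
Qed.

(** Starting from the atom at 0, one step gives [W 1 = X_2] when [X_2] is in []c, e[], and
    stationarity transfers this to [W1]. *)
Lemma stationary_charged (c e : R) : 0 <= c ->
  (0 < P [set t | (c < B 2%N t - A 1%N t < e)%R])%E ->
  (0 < P (W1 @^-1` `]c, e[%classic))%E.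
Proof.
move=> c0 PX.
have [E [mE PE E0 EX]] := charged_path 1 (measurable_set1 0) stationary_atom0 PX.
rewrite -(W1_stationary (measurable_itv `]c, e[)).
apply: (lt_le_trans PE); rewrite le_measure ?inE//.
  by rewrite -[X in measurable X]setTI; exact: mW1.
move=> t Et; have := EX _ Et 0%N isT; have /= W10 := E0 _ Et => /andP[h1 h2].
rewrite /W /= in_itv /= W10 subr0 lt_max h1 orbT gt_max h2 andbT.
by apply: le_lt_trans h2; apply: le_trans c0 (ltW h1).
Qed.

Lemma stationary_covariance_gt0 (a b : R) (k : nat) : 0 < a -> a < b ->
  (forall c e, a <= c -> c < e -> e <= b ->
     (0 < P [set t | (c < B 2%N t - A 1%N t < e)%R])%E) ->
  W 0%N \in Lfun P 1 -> W k \in Lfun P 1 -> W 0%N * W k \in Lfun P 1 ->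
  (0 < ((-1) ^+ k)%:E * covariance P (W 0%N) (W k))%E.
Proof.
move=> a0 ab PX W1L WkL WWL.
have [mD ->] := covariance_waiting (fun n => measurable_funPT (A n))
  (fun n => measurable_funPT (B n)) W1_ge0 W1_AB W1L WkL WWL.
set m := fine _ in mD *; rewrite unlock.
(* [w0] and [x0] trisect []a, b[], so open intervals of radius [r <= x0 - w0] around them stay
   inside. [M] is the smaller point of the 2-cycle [w0], [x0 - w0]; dividing it by [k.+1] makes room
   for the initial error and those of [k] increments. *)
pose w0 := (2 * a + b) / 3; pose x0 := (a + 2 * b) / 3.
pose M := Num.min w0 (x0 - w0); pose r := M / k.+1%:R.
have M_gt0 : 0 < M by rewrite lt_min /w0 /x0; apply/andP; split; lra.
have kr : k.+1%:R * r = M by rewrite mulrC divfK// pnatr_eq0.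
have r_gt0 : 0 < r by rewrite divr_gt0// ltr0n.
have rM : r <= M by rewrite ler_pdivrMr ?ltr0n// ler_peMr ?ler1n// ltW.
have Mw : M <= w0 by rewrite ge_min lexx.
have Mx : M <= x0 - w0 by rewrite ge_min (lexx (x0 - w0)) orbT.
have rx : r <= x0 - w0 by exact: le_trans Mx.
have Xpos : (0 < P [set t | (x0 - r < B 2%N t - A 1%N t < x0 + r)%R])%E.
  by apply: PX; move: rx; rewrite /x0 /w0; lra.
(* [C] is a one-sided neighbourhood of [w0], without [w0] itself, so that the product of differences
   is strictly signed. *)
have [C [mC PC Cw Cm]] : exists C : set R, [/\ measurable C,
    (0 < P (W1 @^-1` C))%E, forall w, C w -> `|w - w0| < r &
    forall w, C w -> (m <= w0 < w) || (w < w0 <= m)].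
  have [mw|wm] := leP m w0.
    exists `]w0, w0 + r[%classic; split.
    - exact: measurable_itv.
    - apply: stationary_charged; first by rewrite /w0; lra.
      by apply: PX; move: rx; rewrite /x0 /w0; lra.
    - by move=> w; rewrite /= in_itv /= => /andP[? ?]; rewrite ltr_norml; lra.
    - by move=> w; rewrite /= in_itv /= => /andP[-> _].
  exists `]w0 - r, w0[%classic; split.
  - exact: measurable_itv.
  - have : 0 < w0 - r by move: rx; rewrite /x0 /w0; lra.
    move=> /ltW ?; apply: stationary_charged => //.
    by apply: PX; move: rx; rewrite /x0 /w0; lra.
  - by move=> w; rewrite /= in_itv /= => /andP[? ?]; rewrite ltr_norml; lra.
  - by move=> w; rewrite /= in_itv /= => /andP[_ ->]; rewrite (ltW wm).
have [E [mE PE EC EX]] := charged_path k mC PC Xpos.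
apply: (integral_gt0 measurableT mD _ mE) => // t.
  by move=> _; exact: waiting_mono_cov.
move=> Et; apply: (@waiting_mono_cov_gt0 _ _ _ _ _ _ _ _ w0 x0 r).
- by rewrite kr.
- by rewrite kr.
- by move=> j /(EX _ Et) /andP[? ?]; rewrite ltr_norml; lra.
- exact/Cw/EC.
- exact/Cm/EC.
Qed.

End stationary.

(** * Use of the density, and conclusion *)

Lemma increment_charged d (T : measurableType d) (R : realType)
    (P : probability T R) (X : T -> R) (a b c e : R) (f : R -> R) :
  measurable_fun `]a, b[ f -> (forall x, a < x < b -> 0 < f x) ->
  (forall C : set R, measurable C -> C `<=` `]a, b[ ->
     P [set t | X t \in C] = (\int[lebesgue_measure]_(x in C) (f x)%:E)%E) ->
  a <= c -> c < e -> e <= b -> (0 < P [set t | (c < X t < e)%R])%E.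
Proof.
move=> mf f_gt0 Pf ac ce eb.
have ceab : `]c, e[ `<=` `]a, b[.
  by apply: subset_itvW.
rewrite (_ : [set _ | _] = [set t | X t \in `]c, e[%classic]); last first.
  by apply/seteqP; split => t; rewrite /= mem_setE in_itv.
rewrite Pf//.
have f_pos x : `]c, e[%classic x -> 0 < f x.
  by move=> /ceab; rewrite /= in_itv => /f_gt0.
apply: (@integral_gt0 _ _ _ lebesgue_measure _ `]c, e[%classic) => //.
- exact: measurable_funS mf.
- by move=> x /f_pos/ltW.
- have : (0 < lebesgue_measure `]c, e[%classic)%E.
    by rewrite lebesgue_measure_itv /= lte_fin ce -EFinB lte_fin subr_gt0.
  exact.
Qed.

Unset Implicit Arguments.

Theorem theorem2p1 (d : measure_display) (T : measurableType d) (R : realType)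
  (P : probability T R) (A B : nat -> {RV P >-> R}) (W1 : {RV P >-> R}) :
  (* {A_n}_{n>=1}, {B_n}_{n>=1}: mutually independent sequences *)
  mutually_independent P (AB_family (fun n => A n : T -> R) (fun n => B n : T -> R)) ->
  (* each sequence identically distributed *)
  (forall n, (1 <= n)%N -> ident_distr P (A n) (A 1%N)) ->
  (forall n, (1 <= n)%N -> ident_distr P (B n) (B 1%N)) ->
  (* W_1 >= 0, independent of {(A_n, B_(n+1))}_{n>=1} *)
  (forall t, 0 <= W1 t) ->
  independent_of P W1 (AB_shift_family (fun n => A n : T -> R) (fun n => B n : T -> R)) ->
  (* P[X > 0] in (0,1), with X distributed as X_2 = B_2 - A_1 *)
  (0 < P [set t | (0 < B 2%N t - A 1%N t)%R])%E ->
  (P [set t | (0 < B 2%N t - A 1%N t)%R] < 1)%E ->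
  let W := waiting (fun n => A n : T -> R) (fun n => B n : T -> R) W1 in
  (* W k = W_(k+1); c(k) = cov[W_1, W_(1+k)] = covariance P (W 0) (W k) *)
  (forall k : nat,
     W 0%N \in Lfun P 1 -> W k \in Lfun P 1 -> (W 0%N * W k)%R \in Lfun P 1 ->
     if odd k then (covariance P (W 0%N) (W k) <= 0)%E
     else (0 <= covariance P (W 0%N) (W k))%E)
  /\
  ((exists (a b : R) (f : R -> R),
      0 < a /\ a < b /\
      measurable_fun `]a, b[ f /\
      (forall x, a < x < b -> 0 < f x) /\
      (forall C : set R, measurable C -> C `<=` `]a, b[ ->
         P [set t | B 2%N t - A 1%N t \in C] =
         (\int[lebesgue_measure]_(x in C) (f x)%:E)%E)) ->
   (* W_1 has the stationary law: W_1 =D max(0, X - W_1), X = X_2 indep. of W_1 *)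
   ident_distr P (W 1%N) (W 0%N) ->
   forall k : nat,
     W 0%N \in Lfun P 1 -> W k \in Lfun P 1 -> (W 0%N * W k)%R \in Lfun P 1 ->
     if odd k then (covariance P (W 0%N) (W k) < 0)%E
     else (0 < covariance P (W 0%N) (W k))%E).
Proof.
move=> indAB idA idB W1_ge0 W1_AB _ X_lt1 W; split => [k W1L WkL WWL|].
  apply: alternating_sign_ge0.
  have [_ ->] := covariance_waiting (fun n => measurable_funPT (A n))
    (fun n => measurable_funPT (B n)) W1_ge0 W1_AB W1L WkL WWL.
  by apply: expectation_ge0 => t; exact: waiting_mono_cov.
move=> [a [b [f [a_gt0 [ab [mf [f_gt0 Pf]]]]]]] stat k W1L WkL WWL.
apply: alternating_sign_gt0.
apply: (stationary_covariance_gt0 indAB idA idB W1_ge0 W1_AB stat X_lt1 a_gt0 ab)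
  => // c e.
exact: increment_charged mf f_gt0 Pf.
Qed.
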